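(* The And Ising interaction family $\mathfrak{I}^{\mathrm{And\text{-}Is}}$ is group--coset (with $S=\{0,1\}$ viewed as the group $\mathbb{Z}/2\mathbb{Z}$), globally satisfiable, functionally representable and contraction-closed.
   Context: The And Ising family $\mathfrak{I}^{\mathrm{And\text{-}Is}}=(S,\{\Phi^k\}_{k\ge0})$ has spin value set $S=\{0,1\}$ (identified with $\mathbb{Z}/2\mathbb{Z}$ when a group structure is needed) and $\Phi^k(s_1,\dots,s_k)=\prod_{i=1}^ks_i$. For an interaction family $(S,\{\Phi^k\}_{k\ge0})$ with $S$ finite and permutation-invariant $\Phi^k\colon S^k\to\{0,1\}$, put $K_{\Phi^k}=\{\boldsymbol{s}\in S^k\mid\Phi^k(\boldsymbol{s})=1\}$, and for $A\subseteq[k]$ let $\boldsymbol{s}|_A=(s_i)_{i\in A}$. Functionally representable: for every $k$ there is a partition $[k]=I\sqcup D$ and a map $\sigma\colon S^{|I|}\to S^{|D|}$ (dependency map) with $K_{\Phi^k}=\{(\boldsymbol{s}_I,\sigma(\boldsymbol{s}_I))\mid\boldsymbol{s}_I\in S^{|I|}\}$ ($\boldsymbol{s}_I$ placed on $I$, $\sigma(\boldsymbol{s}_I)$ on $D$). Contraction-closed (for a functionally representable family): for every $k$, every $k'\ge k$ and every partition $[k]=I\sqcup D$ with a map $\sigma\colon S^{|I|}\to S^{|D|}$ satisfying $K_{\Phi^k}=\{(\boldsymbol{s}_I,\sigma(\boldsymbol{s}_I))\mid\boldsymbol{s}_I\in S^{|I|}\}$ ($\boldsymbol{s}_I$ placed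 on $I$, $\sigma(\boldsymbol{s}_I)$ on $D$), let $\hat\sigma\colon S^{[k']\setminus D}\to S^{[k']}$, $\hat\sigma(\boldsymbol{s})|_{[k']\setminus D}=\boldsymbol{s}$, $\hat\sigma(\boldsymbol{s})|_D=\sigma(\boldsymbol{s}|_I)$; then for every $A\subseteq[k']$ either $\Phi^{|A|}(\hat\sigma(\boldsymbol{s})|_A)$ is constant in $\boldsymbol{s}$, or there is a unique $A'\subseteq[k']\setminus D$ with $\Phi^{|A|}(\hat\sigma(\boldsymbol{s})|_A)=\Phi^{|A'|}(\boldsymbol{s}|_{A'})$ for all $\boldsymbol{s}\in S^{[k']\setminus D}$. Group--coset: $S$ is a finite group and, for all $k\ge0$, $K_{\Phi^k}$ is a coset of a subgroup of $S^k$. Globally satisfiable: there is $s\in S$ with $\Phi^k(s,\dots,s)=1$ for all $k$. *)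

(* Defs.v *)
From HB Require Import structures.
From mathcomp Require Import all_boot all_order all_algebra all_fingroup.

Set Implicit Arguments.
Unset Strict Implicit.
Unset Printing Implicit Defensive.

(* [k] is 'I_k, so a k-tuple in S^k is a finite function {ffun 'I_k -> S}, and
   for a subset X of [k] the tuples in S^X (written S^|X| when only the number
   of entries matters) are finite functions on the subtype {i : 'I_k | i \in X}
   itself, which needs no choice of an ordering of X. *)

Record interaction_family (S : finType) := InteractionFamily {
  Phi : forall k : nat, {ffun 'I_k -> S} -> bool;
  Phi_perm : forall (k : nat) (p : 'S_k) (s : {ffun 'I_k -> S}),
    Phi [ffun i => s (p i)] = Phi s
}.

Definition solutions (S : finType) (F : interaction_family S) (k : nat) :
  {set {ffun 'I_k -> S}} := [set s | Phi F s].

(* s|_A for A a subset of the index type T, listed in the order of enum A as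
   a genuine #|A|-tuple, so that Phi^|A| applies; the order is immaterial by
   Phi_perm. *)
Definition restr (S T : finType) (A : {set T}) (s : {ffun T -> S}) :
  {ffun 'I_#|A| -> S} := [ffun j => s (enum_val j)].

(* The tuple equal to u outside D and to v on D. *)
Definition glue (S T : finType) (D : {set T})
    (u : {ffun {i : T | i \notin D} -> S}) (v : {ffun {i : T | i \in D} -> S}) :
  {ffun T -> S} :=
  [ffun i => match boolP (i \in D) with
             | AltTrue h => v (exist _ i h)
             | AltFalse h => u (exist _ i h)
             end].

(* A partition [k] = I |_| D is given by D, the part I being its complement. *)
Definition depmap (S : finType) (k : nat) (D : {set 'I_k}) :=
  {ffun {i : 'I_k | i \notin D} -> S} -> {ffun {i : 'I_k | i \in D} -> S}.

Definition is_dependency (S : finType) (F : interaction_family S) (k : nat)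
    (D : {set 'I_k}) (sigma : depmap S D) : Prop :=
  solutions F k =
  [set glue u (sigma u) | u : {ffun {i : 'I_k | i \notin D} -> S}].

Definition functionally_representable (S : finType) (F : interaction_family S) :
  Prop :=
  forall k : nat, exists (D : {set 'I_k}) (sigma : depmap S D),
    is_dependency F sigma.

(* D seen as a subset of [k']. *)
Definition widen_set (k k' : nat) (le_kk' : k <= k') (D : {set 'I_k}) :
  {set 'I_k'} := widen_ord le_kk' @: D.

Lemma widen_set_notin (k k' : nat) (le_kk' : k <= k') (D : {set 'I_k})
    (i : 'I_k) :
  i \notin D -> widen_ord le_kk' i \notin widen_set le_kk' D.
Proof.
by rewrite mem_imset // => a b /(congr1 val) /= ab; apply: val_inj.
Qed.

Lemma widen_set_lt (k k' : nat) (le_kk' : k <= k') (D : {set 'I_k})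
    (j : 'I_k') :
  j \in widen_set le_kk' D -> j < k.
Proof. by case/imsetP=> i _ ->; exact: (ltn_ord i). Qed.

Lemma widen_set_in (k k' : nat) (le_kk' : k <= k') (D : {set 'I_k})
    (j : 'I_k') (h : j \in widen_set le_kk' D) :
  Ordinal (widen_set_lt h) \in D.
Proof.
case/imsetP: (h) => i iD ji.
by rewrite (_ : Ordinal _ = i) //; apply: val_inj; rewrite /= ji.
Qed.

Definition widen_out (k k' : nat) (le_kk' : k <= k') (D : {set 'I_k})
    (i : {i : 'I_k | i \notin D}) :
  {j : 'I_k' | j \notin widen_set le_kk' D} :=
  Sub (widen_ord le_kk' (val i)) (widen_set_notin le_kk' (valP i)).

Definition narrow_in (k k' : nat) (le_kk' : k <= k') (D : {set 'I_k})
    (j : {j : 'I_k' | j \in widen_set le_kk' D}) : {i : 'I_k | i \in D} :=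
  Sub (Ordinal (widen_set_lt (valP j))) (widen_set_in (valP j)).

(* sigma-hat : S^([k'] \ D) -> S^[k'], which is the identity outside D and
   s |-> sigma (s|_I) on D. *)
Definition extend (S : finType) (k k' : nat) (le_kk' : k <= k')
    (D : {set 'I_k}) (sigma : depmap S D)
    (s : {ffun {j : 'I_k' | j \notin widen_set le_kk' D} -> S}) :
  {ffun 'I_k' -> S} :=
  glue s [ffun j => sigma [ffun i => s (widen_out le_kk' i)] (narrow_in j)].

Arguments extend {S k k'} le_kk' {D} sigma s.

Definition contraction_closed (S : finType) (F : interaction_family S) : Prop :=
  forall (k k' : nat) (le_kk' : k <= k') (D : {set 'I_k}) (sigma : depmap S D),
    is_dependency F sigma ->
    forall A : {set 'I_k'},
      (exists c : bool,
         forall s, Phi F (restr A (extend le_kk' sigma s)) = c)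
      \/
      (exists! A' : {set {j : 'I_k' | j \notin widen_set le_kk' D}},
         forall s, Phi F (restr A (extend le_kk' sigma s)) = Phi F (restr A' s)).

(* The group {ffun I -> gT} of the library, under pointwise operations, as a
   finGroupType. *)
HB.instance Definition _ (I : finType) (gT : finGroupType) :=
  Finite.on {ffun I -> gT}.

Definition group_coset (S : finGroupType) (F : interaction_family S) : Prop :=
  forall k : nat,
    exists (H : {group {ffun 'I_k -> S}}) (x : {ffun 'I_k -> S}),
      solutions F k = (x *: H)%g.

Definition globally_satisfiable (S : finType) (F : interaction_family S) :
  Prop :=
  exists s : S, forall k : nat, Phi F [ffun _ : 'I_k => s].

(* The spin set {0, 1} is 'Z_2, whose finGroupType structure is addition
   modulo 2; the product of spins, which is 0 or 1, becomes the boolean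
   (_ == 1). *)
Definition and_Phi (k : nat) (s : {ffun 'I_k -> 'Z_2}) : bool :=
  (\prod_(i < k) s i == 1)%R.

Lemma and_Phi_perm (k : nat) (p : 'S_k) (s : {ffun 'I_k -> 'Z_2}) :
  and_Phi [ffun i => s (p i)] = and_Phi s.
Proof.
rewrite /and_Phi [in RHS](reindex_inj (@perm_inj _ p)) /=.
by congr (_ == _); apply: eq_bigr => i _; rewrite ffunE.
Qed.

Definition and_ising : interaction_family 'Z_2 :=
  InteractionFamily and_Phi_perm.

(* Main.v *)
Require Import Defs.
From mathcomp Require Import all_boot all_order all_algebra all_fingroup.

(** The product of spins in {0, 1} is 1 exactly when every spin is 1
    ([and_PhiE]), so the constraint on k spins has the all-ones tuple as its
    only solution ([solutions_and]).  A singleton is a coset of the trivial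
    subgroup; the spin 1 satisfies every constraint; and a single solution is
    the graph of the map that determines all k spins from none.

    For contraction, every dependency map, whatever its domain, takes the
    constant value 1, because its graph consists of solutions
    ([and_dependency_eq1]).  Substituting it into the constraint on A replaces
    the spins of A on D by 1, hence leaves the constraint on A minus D, and A' is
    that set.  It is unique because the constraint on a set determines the set:
    the tuple whose only 0 is at i violates it exactly when i belongs to the set
    ([and_restr_inj]).  Thus the second alternative of contraction-closedness
    always holds, with A' empty when A is contained in D. *)

Set Implicit Arguments.
Unset Strict Implicit.
Unset Printing Implicit Defensive.

Import GRing.Theory.
Local Open Scope ring_scope.

Section Glue.
Variables (S T : finType) (D : {set T}).
Variables (u : {ffun {i : T | i \notin D} -> S}).
Variables (v : {ffun {i : T | i \in D} -> S}).

Lemma glue_in i (iD : i \in D) : glue u v i = v (exist _ i iD).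
Proof.
rewrite ffunE.
by case: {-}_ / boolP => [h | /negP //]; congr (v _); apply: val_inj.
Qed.

Lemma glue_notin i (iND : i \notin D) : glue u v i = u (exist _ i iND).
Proof.
rewrite ffunE.
case: {-}_ / boolP => [h | h]; first by case/negP: (iND).
by congr (u _); apply: val_inj.
Qed.

End Glue.

Lemma and_PhiE k (s : {ffun 'I_k -> 'Z_2}) :
  Phi and_ising s = [forall i, s i == 1].
Proof.
apply/eqP/forallP => [prod1 i | s1]; last first.
  by rewrite big1 // => i _; apply/eqP.
have: s i != 0.
  apply: contra_eq_neq prod1 => si0.
  by rewrite (bigD1 i) //= si0 mul0r eq_sym oner_eq0.
by case: (s i) => [[|[|m]] lt_m].
Qed.

Lemma and_restrE (T : finType) (A : {set T}) (s : {ffun T -> 'Z_2}) :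
  Phi and_ising (restr A s) = [forall (i | i \in A), s i == 1].
Proof.
rewrite and_PhiE; apply/forallP/forall_inP => [s1 i iA | s1 j].
  by have := s1 (enum_rank_in iA i); rewrite ffunE enum_rankK_in.
by rewrite ffunE; apply: s1; apply: enum_valP.
Qed.

(** A set is recovered from its constraint by testing tuples with a single 0;
    this yields the uniqueness of the contracted set. *)
Lemma and_restr_inj (T : finType) (A B : {set T}) :
  (forall s, Phi and_ising (restr A s) = Phi and_ising (restr B s)) -> A = B.
Proof.
have memE (C : {set T}) i :
    (i \in C) = ~~ Phi and_ising (restr C [ffun j => (j != i)%:R]).
  rewrite and_restrE negb_forall_in; apply/idP/exists_inP => [iC | [j jC]].
    by exists i; rewrite // ffunE eqxx.
  by rewrite ffunE; case: (eqVneq j i) jC => [-> | _ _ /eqP].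
by move=> eqAB; apply/setP => i; rewrite !memE eqAB.
Qed.

Lemma solutions_and k : solutions and_ising k = [set [ffun=> 1]].
Proof.
apply/setP => s; rewrite !inE and_PhiE.
apply/forallP/eqP => [s1 | -> i]; last by rewrite ffunE.
by apply/ffunP => i; rewrite ffunE; apply/eqP.
Qed.

(** The glued tuple is a solution, hence all ones, in particular on D. *)
Lemma and_dependency_eq1 k (D : {set 'I_k}) (sigma : depmap 'Z_2 D) u j :
  is_dependency and_ising sigma -> sigma u j = 1.
Proof.
case: j => j jD.
rewrite /is_dependency solutions_and => graphE.
have: glue u (sigma u) \in [set [ffun=> 1]].
  by rewrite graphE; apply/imsetP; exists u.
by move/set1P/ffunP/(_ j); rewrite (glue_in _ _ jD) ffunE.
Qed.

Lemma and_group_coset : group_coset and_ising.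
Proof.
by move=> k; exists 1%G, [ffun=> 1]; rewrite solutions_and mulg1.
Qed.

Lemma and_globally_satisfiable : globally_satisfiable and_ising.
Proof.
by exists 1 => k; rewrite and_PhiE; apply/forallP => i; rewrite ffunE.
Qed.

Lemma and_functionally_representable : functionally_representable and_ising.
Proof.
move=> k; exists setT, (fun=> [ffun=> 1]); rewrite /is_dependency solutions_and.
have glue1 (u : {ffun {i : 'I_k | i \notin setT} -> 'Z_2}) :
    glue u [ffun=> 1] = [ffun=> 1].
  apply/ffunP => i; have iT: i \in [set: 'I_k] by rewrite inE.
  by rewrite (glue_in _ _ iT) !ffunE.
apply/setP => s; apply/set1P/imsetP => [-> | [u _ ->]]; last exact: glue1.
by exists [ffun=> 1]; rewrite ?glue1.
Qed.

Lemma and_contraction_closed : contraction_closed and_ising.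
Proof.
move=> k k' le_kk' D sigma depD A; right.
have contractE s : Phi and_ising (restr A (extend le_kk' sigma s)) =
    Phi and_ising (restr [set j | val j \in A] s).
  rewrite !and_restrE; apply/forall_inP/forall_inP => [s1 [j jND] | s1 i iA].
    by rewrite inE => /s1; rewrite (glue_notin _ _ jND).
  have [iD | iND] := boolP (i \in widen_set le_kk' D).
    by rewrite (glue_in _ _ iD) ffunE and_dependency_eq1.
  by rewrite (glue_notin _ _ iND) s1 ?inE.
exists [set j | val j \in A]; split=> // B eqB.
by apply: and_restr_inj => s; rewrite -contractE eqB.
Qed.

Theorem proposition5p23 :
  group_coset and_ising /\ globally_satisfiable and_ising /\
  functionally_representable and_ising /\ contraction_closed and_ising.
Proof.
split; first exact: and_group_coset.
split; first exact: and_globally_satisfiable.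
split; first exact: and_functionally_representable.
exact: and_contraction_closed.
Qed.
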